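(* Let $f$ be a function defined and integrable on the interval $[a,b]$. For any integer $n\ge 1$, $$\int_{a}^{b}\cdots\int_{a}^{x_3}\int_{a}^{x_2}f(x_1)\,dx_1\,dx_2\cdots dx_n=\frac{b^{n-1}}{(n-1)!}\sum_{k=0}^{n-1}\binom{n-1}{k}\frac{(-1)^k}{b^k}\int_{a}^{b}x^kf(x)\,dx,$$ where $b^{n-1}/b^k$ is read as $b^{n-1-k}$ (so that the formula also makes sense when $b=0$).
   Context: The left-hand side is the $n$-th order definite repeated integral: $x_i$ is integrated from $a$ to $x_{i+1}$ for $i<n$, and $x_n$ from $a$ to $b$. Convention: $x^0=1$. *)

(* Defs.v *)
From HB Require Import structures.
From mathcomp Require Import all_boot all_order all_algebra.
From mathcomp Require Import all_classical all_reals all_analysis.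

Set Implicit Arguments.
Unset Strict Implicit.
Unset Printing Implicit Defensive.

Import Order.TTheory GRing.Theory Num.Theory.
Import numFieldNormedType.Exports.

Local Open Scope classical_set_scope.
Local Open Scope ring_scope.

(* [repeated_integral f a n b] is the n-fold integral
     \int_a^b \int_a^(x_n) ... \int_a^(x_2) f(x_1) dx_1 ... dx_(n-1) dx_n;
   the recursion peels off the outermost integral, whose variable is the upper
   bound of the next one. The set integral over `[a, x] is the integral from a
   to x only for a <= x, which holds for all upper bounds when a <= b.
   The measure is the completed one, so that measurability means Lebesgue
   measurability: a Riemann integrable function need not be Borel. *)
Fixpoint repeated_integral (R : realType) (f : R -> R) (a : R) (n : nat)
    (x : R) : R :=
  if n is m.+1
  then \int[@completed_lebesgue_measure R]_(t in `[a, x]) repeated_integral f a m t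
  else f x.

(* Main.v *)
(* By induction, the (m+1)-fold integral up to x is Cauchy's single integral
   of (x - t)^m / m! f(t) over [a, x]: Fubini on the triangle a <= s <= t <= x
   integrates (t - s)^m f(s) first in t, giving (x - s)^(m+1) / (m+1) f(s).
   The binomial expansion of (b - t)^(n-1) then yields the formula. *)
Require Import Defs.
From HB Require Import structures.
From mathcomp Require Import all_boot all_order all_algebra.
From mathcomp Require Import all_classical all_reals all_analysis.
From mathcomp Require Import measurable_realfun ring lra.

Set Implicit Arguments.
Unset Strict Implicit.
Unset Printing Implicit Defensive.

Import Order.TTheory GRing.Theory Num.Theory.
Import numFieldNormedType.Exports.

Local Open Scope classical_set_scope.
Local Open Scope ring_scope.

(** * Integrals of powers, and truncated powers as kernels *)

Lemma integral_lebesgue_exprB (R : realType) (m : nat) (u v : R) : u <= v ->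
  (\int[@lebesgue_measure R]_(t in `[u, v]) ((t - u) ^+ m)%:E =
   ((v - u) ^+ m.+1 / m.+1%:R)%:E)%E.
Proof.
(* The fundamental theorem of calculus is applied for [u < v]; on a single point both sides are
   0. *)
rewrite le_eqVlt => /predU1P[<-|uv].
  by rewrite set_itv1 integral_set1 subrr expr0n mul0r.
pose F (t : R) := (t - u) ^+ m.+1 / m.+1%:R.
have dF (t : R) : is_derive t (1 : R) F ((t - u) ^+ m).
  have -> : F = m.+1%:R^-1 \*: ((id - cst u) ^+ m.+1).
    by apply/funext => s; rewrite /F/= mulrC exprfctE.
  apply: is_derive_eq.
  by rewrite subr0 scalerA mulrA mulVf ?pnatr_eq0// mul1r [LHS]mulr1.
have cF (t : R) : {for t, continuous F}.
  by apply/differentiable_continuous/derivable1_diffP; exact: ex_derive.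
rewrite (@continuous_FTC2 _ _ F)//.
- by rewrite /F subrr expr0n mul0r sube0.
- apply: continuous_in_subspaceT => t _.
  apply: (@continuous_comp _ _ _ (fun s : R => s - u) (fun s : R => s ^+ m)).
    by apply: cvgB; [exact: cvg_id | exact: cvg_cst].
  exact: exprn_continuous.
- split => [t _||].
  + exact: ex_derive.
  + exact/cvg_at_right_filter/cF.
  + exact/cvg_at_left_filter/cF.
- by move=> t _; rewrite derive1E; exact: derive_val.
Qed.

(** The triangle is encoded in the kernel, so that Fubini can be used on the whole product; [u] is
    the inner variable and [v] the outer one. The lower bound [a] enters through the function that
    multiplies the kernel. *)
Definition truncated_expr (R : realType) (m : nat) (x u v : R) : R :=
  if u <= v <= x then (v - u) ^+ m else 0.

Lemma truncated_expr_ge0 (R : realType) (m : nat) (x u v : R) :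
  0 <= truncated_expr m x u v.
Proof.
by rewrite /truncated_expr; case: ifP => // /andP[uv _]; rewrite exprn_ge0 ?subr_ge0.
Qed.

(* The completed Lebesgue measure lives on a different measurable type than the
   Borel line: [p] plays the role of the identity from the former to the latter.
   Fubini is applied on T * T, with the product of the completed sigma-algebras. *)
Section lebesgue_pushforward.
Context d (T : measurableType d) (R : realType).
Variables (mu : {sigma_finite_measure set T -> \bar R}) (p : T -> R).
Hypothesis mp : measurable_fun [set: T] p.
Hypothesis mupE :
  forall A, measurable A -> mu (p @^-1` A) = @lebesgue_measure R A.

Let mpitv (u v : R) : measurable (p @^-1` `[u, v]).
Proof. by rewrite -[X in measurable X]setTI; exact: mp. Qed.

(** By [mupE] the pushforward of [mu] under [p] is Lebesgue measure on Borel sets, so the integral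
    can be computed on the Borel line. *)
Lemma integral_truncated_expr (m : nat) (x u : R) : u <= x ->
  (\int[mu]_t (truncated_expr m x u (p t))%:E =
   ((x - u) ^+ m.+1 / m.+1%:R)%:E)%E.
Proof.
move=> ux; rewrite -integral_lebesgue_exprB//.
pose mpM := isMeasurableFun.Build _ _ T (measurableTypeR R) p mp.
pose P : {mfun T >-> measurableTypeR R} := HB.pack p mpM.
transitivity (\int[pushforward mu P]_(t in `[u, x]) ((t - u) ^+ m)%:E)%E.
  rewrite ge0_integral_pushforward//.
  - rewrite [RHS]integral_mkcond; apply: eq_integral => t _.
    rewrite /truncated_expr/= patchE.
    case: ifPn => h; first by rewrite ifT// inE/= in_itv.
    by rewrite ifF//; apply/negbTE; apply: contra h; rewrite inE/= in_itv.
  - by apply/measurable_EFinP; apply: measurable_funX; exact: measurable_funB.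
  - move=> y; rewrite inE/= in_itv/= => /andP[uy _].
    by rewrite lee_fin exprn_ge0 ?subr_ge0.
by apply: (eq_measure_integral (@lebesgue_measure R)) => A mA _; exact: mupE.
Qed.

Lemma measurable_truncated_expr (m : nat) (x : R) :
  measurable_fun [set: T * T]
    (fun z => truncated_expr m x (p z.2) (p z.1)).
Proof.
have m1 : measurable_fun [set: T * T] (fun z => p z.1) by exact: measurableT_comp.
have m2 : measurable_fun [set: T * T] (fun z => p z.2) by exact: measurableT_comp.
apply: measurable_fun_ifT => //.
- by apply: measurable_and; apply: measurable_fun_ler.
- by apply: measurable_funX; exact: measurable_funB.
Qed.

Lemma integrable_truncated_expr (m : nat) (x u : R) : u <= x ->
  mu.-integrable [set: T] (fun t => (truncated_expr m x u (p t))%:E).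
Proof.
move=> ux; apply/integrableP; split.
  apply/measurable_EFinP/measurable_fun_ifT => //.
  - by apply: measurable_and; apply: measurable_fun_ler.
  - by apply: measurable_funX; exact: measurable_funB.
under eq_integral do rewrite /= ger0_norm ?truncated_expr_ge0//.
by rewrite integral_truncated_expr// ltry.
Qed.

(** The power is measurable and bounded on the interval, where the values of [p] are at most
    [|a| + |x|] in absolute value. *)
Lemma integrable_exprBl (m : nat) (f : T -> R) (a x y : R) :
  mu.-integrable (p @^-1` `[a, x]) (EFin \o f) ->
  mu.-integrable (p @^-1` `[a, x]) (EFin \o (fun s => (y - p s) ^+ m * f s)).
Proof.
move=> fi; rewrite (_ : EFin \o _ =
    ((EFin \o f) \* (EFin \o (fun s => ((y - p s) ^+ m)%R)))%E); last first.
  by apply/funext => s /=; rewrite EFinM muleC.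
apply: integrableMl => //.
  apply/measurable_funTS/measurable_funX.
  exact: measurable_funB.
exists ((`|y| + (`|a| + `|x|)) ^+ m); split; first exact: num_real.
move=> M ltM s /=; rewrite in_itv/= => /andP[as_ sx].
apply: le_trans (ltW ltM); rewrite normrX lerXn2r//.
  by rewrite nnegrE !addr_ge0.
rewrite (le_trans (ler_normB _ _))// lerD2l ler_norml.
have := ler_norm x; have := ler_norm (- a); rewrite normrN.
have := normr_ge0 x; have := normr_ge0 a.
by move=> *; apply/andP; split; lra.
Qed.

(** * Fubini on the triangle *)

Lemma Rintegral_iterated_exprB (m : nat) (f : T -> R) (a x : R) :
  mu.-integrable (p @^-1` `[a, x]) (EFin \o f) ->
  \int[mu]_(t in p @^-1` `[a, x])
    \int[mu]_(s in p @^-1` `[a, p t]) ((p t - p s) ^+ m * f s) =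
  \int[mu]_(s in p @^-1` `[a, x]) ((x - p s) ^+ m.+1 / m.+1%:R * f s).
Proof.
set D := p @^-1` `[a, x] => fi.
pose g := f \_ D.
have gi : mu.-integrable [set: T] (EFin \o g).
  by rewrite -restrict_EFin; exact/(integrable_mkcond _ (mpitv a x)).
have DE t : (t \in D) = (a <= p t <= x).
  by apply/idP/idP; rewrite inE /D/= in_itv.
have gE s : g s = if a <= p s <= x then f s else 0.
  by rewrite /g patchE DE.
pose h z := ((truncated_expr m x (p z.2) (p z.1)) * g z.2)%:E.
have inner t : ((\int[mu]_(s in p @^-1` `[a, p t]) ((p t - p s) ^+ m * f s))%:E
    * (\1_D t)%:E = \int[mu]_s h (t, s))%E.
  (* Off [D] the integrand vanishes: the kernel needs [p s <= p t <= x] and [g] needs [a <= p s],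
     which together put [t] in [D]. *)
  rewrite indicE/=; have [tD|tD] := boolP (t \in D); last first.
    rewrite mule0 integral0_eq// => s _; rewrite /h/= gE /truncated_expr.
    case: ifPn => [/andP[st tx]|]; last by rewrite mul0r.
    case: ifPn => [/andP[sa sx]|]; last by rewrite mulr0.
    by move: tD; rewrite DE tx (le_trans sa st).
  move: tD; rewrite DE => /andP[at_ tx].
  have itvS : p @^-1` `[a, p t] `<=` D.
    by move=> s /=; rewrite /D/= !in_itv/= => /andP[-> /le_trans->].
  rewrite mule1 /Rintegral fineK; last first.
    apply: integrable_fin_num => //; apply: integrable_exprBl.
    by apply: integrableS fi => //; exact: mpitv.
  rewrite integral_mkcond; apply: eq_integral => s _.
  rewrite patchE /h/= gE /truncated_expr tx andbT.
  case: ifPn.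
    by rewrite inE/= in_itv/= => /andP[as_ st]; rewrite st as_ (le_trans st tx).
  rewrite notin_setE/= in_itv/=.
  case: (leP a (p s)) => as_/=; last by rewrite mulr0.
  by move=> /negP/negbTE->; rewrite mul0r.
(* Stated for a general [g0] because it serves twice: with [|g|] for integrability of [h], and with
   [g] for the value after the swap. *)
have outer (g0 : T -> R) s : (forall r, x < p r -> g0 r = 0) ->
    (\int[mu]_t (truncated_expr m x (p s) (p t) * g0 s)%:E =
    ((x - p s) ^+ m.+1 / m.+1%:R * g0 s)%:E)%E.
  move=> g0x; case: (leP (p s) x) => sx; last first.
    by rewrite g0x// mulr0 integral0_eq// => t _; rewrite mulr0.
  under eq_integral do rewrite EFinM muleC.
  rewrite integralZl//; last exact: integrable_truncated_expr.
  by rewrite integral_truncated_expr// -EFinM mulrC.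
have gx s : x < p s -> g s = 0 by rewrite gE [p s <= x]leNgt => ->; rewrite andbF.
have mh : measurable_fun [set: T * T] h.
  apply/measurable_EFinP/measurable_funM; first exact: measurable_truncated_expr.
  apply: (@measurableT_comp _ _ _ _ _ _ g) => //.
  by apply/measurable_EFinP; exact: measurable_int gi.
have hi : (mu \x mu)%E.-integrable [set: T * T] h.
  (* Tonelli: it suffices that the iterated integral of [|h|], taken in [t] first, is finite. The
     integral in [t] is [|G s|], and [G] is integrable. *)
  apply/integrable21ltyP => //.
  pose G s := (x - p s) ^+ m.+1 / m.+1%:R * g s.
  have Gi : mu.-integrable [set: T] (EFin \o G).
    rewrite (_ : _ \o _ =
        (fun s => (m.+1%:R^-1)%:E * (EFin \o (fun s => (x - p s) ^+ m.+1 * f s)%R) s)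
        \_ D)%E.
      apply/(integrable_mkcond _ (mpitv a x)).
      by apply: integrableZl; [exact: mpitv | exact: integrable_exprBl].
    apply/funext => s; rewrite /G /g /= !patchE; case: ifPn => _ /=.
      by rewrite -EFinM mulrA [_^-1 * _]mulrC.
    by rewrite mulr0.
  have /integrableP[_] := Gi; apply: le_lt_trans.
  rewrite le_eqVlt; apply/orP; left; apply/eqP; apply: eq_integral => s _.
  transitivity (\int[mu]_t (truncated_expr m x (p s) (p t) * `|g s|)%:E)%E.
    apply: eq_integral => t _.
    by rewrite /h/= normrM ger0_norm// truncated_expr_ge0.
  rewrite (outer (fun s => `|g s|)); last by move=> r /gx->; rewrite normr0.
  rewrite /= /G normrM; have [sx|xs] := leP (p s) x.
    by rewrite (@ger0_norm _ (_ / _))// divr_ge0// exprn_ge0// subr_ge0.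
  by rewrite gx// normr0 !mulr0.
rewrite /Rintegral; congr fine.
transitivity (\int[mu]_t \int[mu]_s h (t, s))%E.
  rewrite integral_mkcond; apply: eq_integral => t _.
  by rewrite -inner patchE indicE; case: ifPn => _; rewrite ?mule1 ?mule0.
rewrite Fubini// [RHS]integral_mkcond; apply: eq_integral => s _.
by rewrite [LHS](outer g s gx) /g !patchE; case: ifPn => // _; rewrite mulr0.
Qed.

Lemma Rintegral_iterated_exprB_fact (m : nat) (f : T -> R) (a x : R) :
  mu.-integrable (p @^-1` `[a, x]) (EFin \o f) ->
  \int[mu]_(t in p @^-1` `[a, x])
    \int[mu]_(s in p @^-1` `[a, p t]) ((p t - p s) ^+ m / m`!%:R * f s) =
  \int[mu]_(s in p @^-1` `[a, x]) ((x - p s) ^+ m.+1 / (m.+1)`!%:R * f s).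
Proof.
(* The constant [1/m!] is absorbed into the function; the new factor [1/(m+1)] then completes the
   factorial. *)
move=> fi; pose g t := m`!%:R^-1 * f t.
transitivity (\int[mu]_(t in p @^-1` `[a, x])
    \int[mu]_(s in p @^-1` `[a, p t]) ((p t - p s) ^+ m * g s)).
  by apply: eq_Rintegral => t _; apply: eq_Rintegral => s _; rewrite mulrA.
rewrite Rintegral_iterated_exprB; last exact: (integrableZl (mpitv a x) m`!%:R^-1 fi).
by apply: eq_Rintegral => s _; rewrite factS natrM invfM !mulrA.
Qed.

(** * Binomial expansion of the kernel *)

Lemma Rintegral_exprB_expand (m : nat) (f : T -> R) (a x y : R) :
  mu.-integrable (p @^-1` `[a, x]) (EFin \o f) ->
  \int[mu]_(t in p @^-1` `[a, x]) ((y - p t) ^+ m / m`!%:R * f t) =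
  m`!%:R^-1 * \sum_(0 <= k < m.+1) 'C(m, k)%:R * (-1) ^+ k * y ^+ (m - k) *
    \int[mu]_(t in p @^-1` `[a, x]) (p t ^+ k * f t).
Proof.
move=> fi.
have pfi k : mu.-integrable (p @^-1` `[a, x]) (EFin \o (fun t => p t ^+ k * f t)).
  (* A plain power is a shifted one with [y = 0], up to sign:
     [r ^+ k = (-1) ^+ k * (0 - r) ^+ k]. *)
  have := integrableZl (mpitv a x) ((-1) ^+ k) (integrable_exprBl k 0 fi).
  apply: eq_integrable; first exact: mpitv.
  by move=> t _ /=; rewrite -EFinM sub0r mulrA -exprMn mulN1r opprK.
under eq_Rintegral do rewrite -mulrA mulrCA.
rewrite RintegralZl//; last exact: integrable_exprBl.
congr (_ * _).
transitivity (fine (\int[mu]_(t in p @^-1` `[a, x])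
    (\sum_(0 <= k < m.+1) ('C(m, k)%:R * (-1) ^+ k * y ^+ (m - k))%:E *
       (p t ^+ k * f t)%:E))%E).
  congr fine; apply: eq_integral => t _.
  rewrite exprBn mulr_suml big_mkord -sumEFin; apply: eq_bigr => i _.
  by rewrite -EFinM; congr EFin; rewrite -mulr_natl; ring.
(* Sum and integral are exchanged in the extended reals; every term has a finite integral, so [fine]
   loses nothing. *)
rewrite integral_sum; [|exact: mpitv|]; last first.
  by move=> k; exact: (integrableZl (mpitv a x) _ (pfi k)).
rewrite (eq_bigr (fun k => ('C(m, k)%:R * (-1) ^+ k * y ^+ (m - k) *
    \int[mu]_(t in p @^-1` `[a, x]) (p t ^+ k * f t))%:E)).
  by rewrite sumEFin.
move=> k _; rewrite (integralZl (mpitv a x) (pfi k)).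
rewrite [RHS]EFinM /Rintegral fineK//.
exact: (integrable_fin_num (mpitv a x) (pfi k)).
Qed.

End lebesgue_pushforward.

(** * Specialization to the completed Lebesgue measure *)

Local Notation completedR R :=
  (caratheodory_type (wlength (@idfun R) : set (ocitv_type R) -> \bar R)^*%mu).

(** Provides the map [p] of the section: Borel sets are Caratheodory measurable. *)
Lemma measurable_completedR_id (R : realType) :
  measurable_fun [set: completedR R] (fun x : completedR R => x : R).
Proof. by move=> _ A mA; rewrite setTI; exact: sub_caratheodory. Qed.

Lemma measurable_completedR_itv (R : realType) (i : interval R) :
  measurable ([set` i] : set (completedR R)).
Proof. by apply: sub_caratheodory; exact: measurable_itv. Qed.

Lemma repeated_integralE (R : realType) (m : nat) (f : R -> R) (a x : R) :
  (@completed_lebesgue_measure R).-integrable `[a, x] (EFin \o f) ->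
  repeated_integral f a m.+1 x =
    \int[@completed_lebesgue_measure R]_(t in `[a, x])
      ((x - t) ^+ m / m`!%:R * f t).
Proof.
have mid := @measurable_completedR_id R.
(* The upper bound is generalized, since the inner integrals end at [t] and the induction hypothesis
   is applied there. *)
elim: m x => [x _|m IH x fi].
  by apply: eq_Rintegral => t _; rewrite expr0 fact0 divr1 mul1r.
(* [erefl]: both Lebesgue measures are the same outer measure, restricted to
   different sigma-algebras. *)
have Fub := @Rintegral_iterated_exprB_fact _ _ R completed_lebesgue_measure _ mid.
rewrite [RHS](esym (Fub (fun A _ => erefl) m f a x fi)).
apply: eq_Rintegral => t; rewrite inE/= in_itv/= => /andP[at_ tx].
apply: (IH t).
apply: (integrableS (measurable_completedR_itv _) (measurable_completedR_itv _) _ fi).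
by move=> s /=; rewrite !in_itv/= => /andP[-> /le_trans->].
Qed.

Theorem theorem2p4 (R : realType) (f : R -> R) (a b : R) (n : nat)
    (hab : a <= b)
    (hf : (@completed_lebesgue_measure R).-integrable `[a, b] (EFin \o f))
    (hn : (1 <= n)%N) :
  repeated_integral f a n b =
    ((n.-1)`!%:R)^-1 *
    \sum_(0 <= k < n)
      'C(n.-1, k)%:R * (-1) ^+ k * b ^+ (n.-1 - k) *
      \int[@completed_lebesgue_measure R]_(x in `[a, b]) (x ^+ k * f x).
Proof.
case: n hn => // m _.
rewrite (repeated_integralE m hf).
exact: (@Rintegral_exprB_expand _ _ R completed_lebesgue_measure _
  (@measurable_completedR_id R) m f a b b hf).
Qed.
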